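(* Let $H$ be a separable complex Hilbert space, let $J$ be a conjugation on $H$, and let $A$ be a linear operator in $H$ with domain $D(A)$ and range $R(A)$. (a) If $A$ is $J$-skew-symmetric and $\overline{D(A)}=H$, then there exist a separable Hilbert space $\widetilde H\supseteq H$, a conjugation $\widetilde J$ on $\widetilde H$ extending $J$ (i.e. $\widetilde J x = Jx$ for all $x\in H$), and a $\widetilde J$-skew-self-adjoint operator $\widetilde A$ in $\widetilde H$ which extends $A$ (i.e. $D(A)\subseteq D(\widetilde A)$ and $\widetilde A x = Ax$ for all $x\in D(A)$). (b) If $A$ is $J$-isometric and $\overline{D(A)}=\overline{R(A)}=H$, then there exist a separable Hilbert space $\widetilde H\supseteq H$, a conjugation $\widetilde J$ on $\widetilde H$ extending $J$, and a $\widetilde J$-unitary operator $\widetilde A$ in $\widetilde H$ which extends $A$.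
   Context: All Hilbert spaces are complex and separable. A linear operator $A$ in a Hilbert space $H$ is a linear map defined on a linear subspace $D(A)\subseteq H$ (not necessarily closed or bounded) with values in $H$; $R(A)$ is its range, $\overline{M}$ denotes norm closure, and $A^*$ is the adjoint of $A$ when $A$ is densely defined. The notation $\widetilde H\supseteq H$ means that $H$ is a closed subspace of $\widetilde H$ with the inner product inherited from $\widetilde H$ (the case $\widetilde H=H$ is allowed). A conjugation $J$ on $H$ is an antilinear operator defined on all of $H$ such that $J^2x=x$ for all $x\in H$ and $(Jx,Jy)_H=(y,x)_H$ for all $x,y\in H$. It generates the bilinear form $[x,y]_J:=(x,Jy)_H$, $x,y\in H$ (the inner product is linear in its first argument). A linear operator $A$ in $H$ is called $J$-skew-symmetric if $[Ax,y]_J=-[x,Ay]_J$ for all $x,y\in D(A)$, and $J$-isometric if $[Ax,Ay]_J=[x,y]_J$ for all $x,y\in D(A)$. A densely defined linear operator $A$ in $H$ is called $J$-skew-self-adjoint if $JAJ=-A^*$, and $J$-unitary if $A$ is invertible (injective, with inverse $A^{-1}$ having domain $R(A)$) and $JA^{-1}J=A^*$. These are equalities of (possibly unbounded) operators, including equality of domains. *)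

(* Defs.v *)
From HB Require Import structures.
From mathcomp Require Import all_boot all_order all_algebra.
From mathcomp Require Import sesquilinear.
From mathcomp Require Import all_classical all_reals all_analysis.
From mathcomp.real_closed Require Import complex.

Set Implicit Arguments.
Unset Strict Implicit.
Unset Printing Implicit Defensive.

Import Order.TTheory GRing.Theory Num.Theory.
Import numFieldNormedType.Exports.

Local Open Scope classical_set_scope.
Local Open Scope ring_scope.

(* In a [{dot H for theta}] the form is linear in its first argument and
   theta-linear in the second. *)
HB.mixin Record CompleteNormedModule_isHilbert (R : realType) H
    & CompleteNormedModule R[i] H := {
  inner : {dot H for (@Num.conj R[i])} ;
  normr_sqr_inner : forall x : H, `|x| ^+ 2 = inner x x
}.

#[short(type="hilbertType")]
HB.structure Definition Hilbert (R : realType) :=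
  {H of CompleteNormedModule R[i] H & CompleteNormedModule_isHilbert R H}.

Definition separable_space (T : topologicalType) : Prop :=
  exists2 S : set T, countable S & closure S = setT.

(* H is identified with its image under [iota]. *)
Definition closed_subspace_embedding (R : realType) (H Ht : hilbertType R)
    (iota : H -> Ht) : Prop :=
  [/\ linear iota,
      forall x y : H, inner (iota x) (iota y) = inner x y &
      closed (range iota)].

Section Conjugation.
Variables (R : realType) (H : hilbertType R).

Definition conjugation (J : H -> H) : Prop :=
  [/\ forall (a : R[i]) (x y : H), J (a *: x + y) = a^* *: J x + J y,
      forall x : H, J (J x) = x &
      forall x y : H, inner (J x) (J y) = inner y x].

Definition Jform (J : H -> H) (x y : H) : R[i] := inner x (J y).

End Conjugation.

(* The values of [papp] outside [dom] are irrelevant: operators are compared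
   with [hop_eq] below, never with Leibniz equality. *)
Record hop (R : realType) (H : hilbertType R) := HOp {
  dom : set H ;
  papp :> H -> H }.

Section Operators.
Variables (R : realType) (H : hilbertType R).
Implicit Types (A B : hop H) (J : H -> H).

Definition hop_eq A B : Prop :=
  dom A = dom B /\ forall x, dom A x -> A x = B x.

Definition linear_operator A : Prop :=
  dom A 0 /\
  forall (a : R[i]) (x y : H), dom A x -> dom A y ->
    dom A (a *: x + y) /\ A (a *: x + y) = a *: A x + A y.

Definition ran A : set H := A @` dom A.

Definition densely_defined A : Prop := closure (dom A) = setT.

(* [z] is unique when [A] is densely defined; otherwise the choice made by
   [xget] is arbitrary. *)
Definition adjoint A : hop H :=
  let rel y := [set z | forall x, dom A x -> inner (A x) y = inner x z] in
  HOp [set y | rel y !=set0] (fun y => xget 0 (rel y)).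

Definition oppop A : hop H := HOp (dom A) (fun x => - A x).

Definition injective_op A : Prop :=
  forall x y, dom A x -> dom A y -> A x = A y -> x = y.

(* Meaningful for [A] satisfying [injective_op]. *)
Definition invop A : hop H :=
  HOp (ran A) (fun y => xget 0 [set x | dom A x /\ A x = y]).

(* The composition J A J on its natural domain. *)
Definition Jconj J A : hop H :=
  HOp [set x | dom A (J x)] (fun x => J (A (J x))).

Definition Jskew_symmetric J A : Prop :=
  forall x y, dom A x -> dom A y -> Jform J (A x) y = - Jform J x (A y).

Definition Jisometric J A : Prop :=
  forall x y, dom A x -> dom A y -> Jform J (A x) (A y) = Jform J x y.

Definition Jskew_selfadjoint J A : Prop :=
  [/\ linear_operator A, densely_defined A &
      hop_eq (Jconj J A) (oppop (adjoint A))].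

Definition Junitary J A : Prop :=
  [/\ linear_operator A, densely_defined A, injective_op A &
      hop_eq (Jconj J (invop A)) (adjoint A)].

End Operators.

Section Extensions.
Variables (R : realType) (H Ht : hilbertType R) (iota : H -> Ht).

Definition extends_conj (J : H -> H) (Jt : Ht -> Ht) : Prop :=
  forall x, Jt (iota x) = iota (J x).

Definition extends_op (A : hop H) (At : hop Ht) : Prop :=
  forall x, dom A x -> dom At (iota x) /\ At (iota x) = iota (A x).

End Extensions.

(* Main.v *)
Require Import Defs.
From HB Require Import structures.
From mathcomp Require Import all_boot all_order all_algebra.
From mathcomp Require Import sesquilinear ring.
From mathcomp Require Import all_classical all_reals all_analysis.
From mathcomp.real_closed Require Import complex.

Set Implicit Arguments.
Unset Strict Implicit.
Unset Printing Implicit Defensive.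

Import Order.TTheory GRing.Theory Num.Theory.
Import numFieldNormedType.Exports.

Local Open Scope classical_set_scope.
Local Open Scope ring_scope.

(** Both classes of operators are described by one symmetric bilinear form on
    the graph space H * H. Write [x, y] for (x, J y), which is symmetric and
    bilinear, and put
      skew      B((x, u), (y, v)) = [u, y] + [x, v],
      isometric B((x, u), (y, v)) = [u, v] - [x, y].
    An operator is J-skew-symmetric (J-isometric) exactly when its graph G is
    isotropic, that is G is contained in its B-orthogonal G'.  Computing the
    adjoint through the form shows that an operator with dense domain (and
    dense range, in the isometric case) is J-skew-self-adjoint (J-unitary)
    when its graph satisfies G = G': these are [skew_form_selforth] and
    [isometric_form_selforth].  Density also makes any such self-orthogonal
    relation single-valued, since B pairs (0, u) with (y, v) to [u, y] or
    [u, v].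

    So the problem is to enlarge an isotropic graph to a self-orthogonal one.
    Inside H * H there is a parity obstruction: B induces a nondegenerate
    symmetric form on the quotient of G' by the closure of G, and when this
    quotient has odd dimension it has no self-orthogonal subspace.  Doubling
    the space removes the obstruction: with the form B + B on two copies of
    H * H, the space
      L = { (a, b) | a in G', b - i a in G'' }
    is self-orthogonal.  It is isotropic because a and i a contribute B(a, a')
    and i^2 B(a, a') = - B(a, a'), and the remaining terms vanish by G'' being
    contained in G'; it is its own orthogonal because G'', taken in place of
    the closure of G, is by definition the orthogonal of G'
    ([doubling_selforth]).  Read as a relation on H (+) H, the space L contains
    the pairs ((x, 0), (A x, 0)) for x in D(A), as well as the graph of
    A (+) A, so its domain and range inherit the density of those of A. *)

(** * Self-orthogonal doubling of an isotropic set *)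

Definition orth (T : Type) (C : nzRingType) (b : T -> T -> C) (S : set T) :
    set T :=
  [set x | forall y, S y -> b x y = 0].

Section Doubling.
Variables (C : numClosedFieldType) (V : lmodType C) (B : V -> V -> C).
Hypotheses (B_sym : forall x y, B x y = B y x)
           (B_linear : forall z, scalar (B^~ z)).

Definition double_form (p q : V * V) : C := B p.1 q.1 + B p.2 q.2.

(** For isotropic [S], this is modulo [orth B (orth B S)] the graph of
    multiplication by 'i on [orth B S]. That graph is isotropic for
    [double_form] because 'i ^+ 2 = -1. *)
Definition doubling (S : set V) : set (V * V) :=
  [set p | orth B S p.1 /\ orth B (orth B S) (p.2 - 'i *: p.1)].

Lemma formDl x y z : B (x + y) z = B x z + B y z.
Proof. by have := B_linear z 1 x y; rewrite scale1r mul1r. Qed.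

Lemma form0l z : B 0 z = 0.
Proof. by apply: (addrI (B 0 z)); rewrite -formDl !addr0. Qed.

Lemma formZl a x z : B (a *: x) z = a * B x z.
Proof. by have := B_linear z a x 0; rewrite /= form0l !addr0. Qed.

Lemma formZr a x z : B x (a *: z) = a * B x z.
Proof. by rewrite B_sym formZl B_sym. Qed.

Lemma formDr x y z : B x (y + z) = B x y + B x z.
Proof. by rewrite B_sym formDl B_sym (B_sym z). Qed.

Lemma orth_comb (S : set V) a x y :
  orth B S x -> orth B S y -> orth B S (a *: x + y).
Proof.
by move=> Sx Sy z Sz; rewrite formDl formZl Sx// Sy// mulr0 addr0.
Qed.

Lemma orth0 (S : set V) : orth B S 0.
Proof. by move=> z _; rewrite form0l. Qed.

Lemma orthZ (S : set V) a x : orth B S x -> orth B S (a *: x).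
Proof. by move=> Sx z Sz; rewrite formZl Sx// mulr0. Qed.

Lemma sub_biorth (S : set V) : S `<=` orth B (orth B S).
Proof. by move=> x Sx y /(_ x Sx); rewrite B_sym. Qed.

(** For the inclusion of the orthogonal in [doubling S], pairing (c, d) with
    (0, g) for g in [S] puts d in the orthogonal of [S], and pairing it with
    (a, i a) for a in the orthogonal of [S] puts c + i d in the biorthogonal;
    the two conditions defining [doubling S] follow by linear combination. *)
Lemma doubling_selforth (S : set V) :
  S `<=` orth B S -> orth double_form (doubling S) = doubling S.
Proof.
move=> SS.
have S2S x : orth B (orth B S) x -> orth B S x.
  by move=> Sx y /SS; apply: Sx.
have iK (x : V) : 'i *: ('i *: x) = - x.
  by rewrite scalerA -expr2 sqrCi scaleN1r.
apply/seteqP; split=> [[c d] cd|[c d] [/= Sc Sd] [a b] [/= Sa Sb]].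
  have Sd : orth B S d.
    move=> g Sg; have := cd (0, g); rewrite /double_form /= B_sym form0l add0r.
    apply; split=> /=; first exact: orth0.
    by rewrite scaler0 subr0; apply: sub_biorth.
  have Scd : orth B (orth B S) (c + 'i *: d).
    move=> a Sa; have := cd (a, 'i *: a).
    rewrite /double_form /= formDl formZl formZr; apply; split=> //=.
    by rewrite subrr; apply: orth0.
  split=> /=; last first.
    have -> : d - 'i *: c = (- 'i) *: (c + 'i *: d).
      by rewrite scalerDr !scaleNr iK opprK addrC.
    exact: orthZ.
  have -> : c = (- 'i) *: d + (c + 'i *: d).
    by rewrite addrC scaleNr addrK.
  by apply: orth_comb => //; apply: S2S.
rewrite /double_form /=.
rewrite -[d](subrK ('i *: c)) -[b](subrK ('i *: a)).
move: (d - _) (b - _) Sd Sb => u v Su Sv.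
rewrite !formDl !formDr !formZl !formZr (Su v) ?(Su a)//; last exact: S2S.
rewrite (B_sym c v) (Sv c)// !(mulr0, add0r, addr0) mulrA -expr2 sqrCi.
by rewrite mulN1r subrr.
Qed.

End Doubling.

(** * Direct sums of Hilbert spaces *)

Lemma minkowski2 (C : numClosedFieldType) (a b c d : C) :
  0 <= a -> 0 <= b -> 0 <= c -> 0 <= d ->
  sqrtC ((a + c) ^+ 2 + (b + d) ^+ 2)
    <= sqrtC (a ^+ 2 + b ^+ 2) + sqrtC (c ^+ 2 + d ^+ 2).
Proof.
move=> a0 b0 c0 d0.
have p0 : 0 <= a ^+ 2 + b ^+ 2 by rewrite addr_ge0// exprn_ge0.
have q0 : 0 <= c ^+ 2 + d ^+ 2 by rewrite addr_ge0// exprn_ge0.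
have r0 : 0 <= (a + c) ^+ 2 + (b + d) ^+ 2.
  by rewrite addr_ge0// exprn_ge0// addr_ge0.
rewrite -ler_sqr ?nnegrE ?sqrtC_ge0//; last by rewrite addr_ge0 ?sqrtC_ge0.
rewrite sqrtCK [leRHS]sqrrD !sqrtCK -sqrtCM//.
have h : a * c + b * d <= sqrtC ((a ^+ 2 + b ^+ 2) * (c ^+ 2 + d ^+ 2)).
  rewrite -ler_sqr ?nnegrE ?addr_ge0 ?sqrtC_ge0 ?mulr_ge0//.
  rewrite sqrtCK -subr_ge0.
  (* Lagrange's identity gives the planar Cauchy-Schwarz inequality. *)
  have -> : (a ^+ 2 + b ^+ 2) * (c ^+ 2 + d ^+ 2) - (a * c + b * d) ^+ 2
           = (a * d - b * c) ^+ 2 by ring.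
  by rewrite -realEsqr realB// realM// ger0_real.
rewrite -subr_ge0 in h; rewrite -subr_ge0.
set s := sqrtC _ in h *.
have -> : a ^+ 2 + b ^+ 2 + s *+ 2 + (c ^+ 2 + d ^+ 2)
           - ((a + c) ^+ 2 + (b + d) ^+ 2) = (s - (a * c + b * d)) *+ 2 by ring.
by rewrite mulrn_wge0.
Qed.

Lemma inner_conj (R : realType) (H : hilbertType R) (x y : H) :
  inner x y = (inner y x)^*.
Proof. by rewrite [LHS]hermitian_subproof expr0 mul1r. Qed.

Section DirectSum.
Variables (R : realType) (H K : hilbertType R).
Local Notation C := R[i].

(** A separate name for the product type: [H * K] already carries the maximum
    norm, which does not come from an inner product. *)
Definition dsum : Type := (H * K)%type.
HB.instance Definition _ := GRing.Lmodule.copy dsum (H * K)%type.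

Definition dsum_norm (p : dsum) : C := sqrtC (`|p.1| ^+ 2 + `|p.2| ^+ 2).

Lemma dsum_norm_sqr p : dsum_norm p ^+ 2 = `|p.1| ^+ 2 + `|p.2| ^+ 2.
Proof. exact: sqrtCK. Qed.

Lemma dsum_normD p q : dsum_norm (p + q) <= dsum_norm p + dsum_norm q.
Proof.
apply: le_trans (minkowski2 _ _ _ _) => //.
have sq0 (x y : C) : 0 <= x -> 0 <= y -> 0 <= x ^+ 2 + y ^+ 2.
  by move=> *; rewrite addr_ge0// exprn_ge0.
by rewrite ler_sqrtC ?nnegrE ?sq0 ?addr_ge0// lerD//
  ler_sqr ?nnegrE ?addr_ge0// ler_normD.
Qed.

Lemma dsum_normZ (l : C) p : dsum_norm (l *: p) = `|l| * dsum_norm p.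
Proof.
rewrite /dsum_norm /= !normrZ !exprMn -mulrDr rootCMl ?exprn_ge0//.
by rewrite sqrCK.
Qed.

Lemma dsum_norm0_eq0 p : dsum_norm p = 0 -> p = 0.
Proof.
move=> /(congr1 (fun x => x ^+ 2)); rewrite dsum_norm_sqr expr0n/=.
move/eqP; rewrite paddr_eq0 ?exprn_ge0// !expf_eq0/= !normr_eq0.
by case: p => x y /= /andP[/eqP-> /eqP->].
Qed.

HB.instance Definition _ := @Lmodule_isNormed.Build C dsum dsum_norm
  dsum_normD dsum_normZ dsum_norm0_eq0.

Lemma dsum_normr_sqr (p : dsum) : `|p| ^+ 2 = `|p.1| ^+ 2 + `|p.2| ^+ 2.
Proof. exact: dsum_norm_sqr. Qed.

Lemma dsum_fst_le (p : dsum) : `|p.1| <= `|p|.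
Proof.
by rewrite -ler_sqr ?nnegrE// dsum_normr_sqr lerDl exprn_ge0.
Qed.

Lemma dsum_snd_le (p : dsum) : `|p.2| <= `|p|.
Proof.
by rewrite -ler_sqr ?nnegrE// dsum_normr_sqr lerDr exprn_ge0.
Qed.

Lemma dsum_le (p : dsum) : `|p| <= `|p.1| + `|p.2|.
Proof.
rewrite -ler_sqr ?nnegrE ?addr_ge0// dsum_normr_sqr.
by rewrite sqrrD addrAC lerDl mulrn_wge0// mulr_ge0.
Qed.

(** The two projections are contractions, so they carry a Cauchy filter to
    Cauchy filters, and [dsum_le] recombines the limits. *)
Lemma dsum_complete (F : set_system dsum) :
  ProperFilter F -> cauchy F -> cvg F.
Proof.
move=> FF /cauchyP F_cauchy.
have cvg_proj (L : hilbertType R) (f : dsum -> L) :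
    (forall p q, `|f p - f q| <= `|p - q|) -> cvg (f @ F).
  move=> f_le; apply: cauchy_cvg; apply/cauchyP => e e0.
  have [p Fp] := F_cauchy e e0; exists (f p).
  suff : F (f @^-1` ball (f p) e) by [].
  apply: filterS Fp => q; rewrite -!ball_normE /=.
  exact: le_lt_trans (f_le _ _).
have /cvg_ex[l1 Fl1] := cvg_proj H fst (fun p q => dsum_fst_le (p - q)).
have /cvg_ex[l2 Fl2] := cvg_proj K snd (fun p q => dsum_snd_le (p - q)).
apply/cvg_ex; exists (l1, l2); apply/cvgrPdist_lt => e e0; near=> p.
apply: le_lt_trans (dsum_le _) _ => /=; rewrite [ltRHS]splitr ltrD//; near: p.
- by move/cvgrPdist_lt : Fl1; apply; rewrite divr_gt0.
- by move/cvgrPdist_lt : Fl2; apply; rewrite divr_gt0.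
Unshelve. all: by end_near. Qed.

HB.instance Definition _ := Uniform_isComplete.Build dsum dsum_complete.

Definition dsum_inner (p q : dsum) : C := inner p.1 q.1 + inner p.2 q.2.

Lemma dsum_inner_linearl q : scalar (dsum_inner^~ q).
Proof.
move=> a x y; rewrite /dsum_inner /= !linearDl/= !linearZl_LR/=; ring.
Qed.

Lemma dsum_inner_conj p q : dsum_inner p q = (dsum_inner q p)^*.
Proof. by rewrite /dsum_inner rmorphD/= -!inner_conj. Qed.

Lemma dsum_inner_linearr p :
  GRing.linear_for (@Num.conj C \; *%R) (dsum_inner p).
Proof.
move=> a x y; rewrite dsum_inner_conj dsum_inner_linearl rmorphD rmorphM/=.
by rewrite -!dsum_inner_conj.
Qed.

Lemma dsum_inner_gt0 p : p != 0 -> 0 < dsum_inner p p.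
Proof.
rewrite /dsum_inner -!normr_sqr_inner -dsum_normr_sqr => p0.
by rewrite exprn_gt0// normr_gt0.
Qed.

Lemma dsum_inner_herm p q :
  dsum_inner p q = (-1) ^+ false * (dsum_inner q p)^*.
Proof. by rewrite expr0 mul1r -dsum_inner_conj. Qed.

HB.instance Definition _ := @isBilinear.Build C dsum dsum C
  *%R (@Num.conj C \; *%R) dsum_inner
  (fun u' => zmod_morphism_linear (dsum_inner_linearl u'))
  (fun u => zmod_morphism_linear (dsum_inner_linearr u))
  (fun u' => scalable_linear (dsum_inner_linearl u'))
  (fun u => scalable_linear (dsum_inner_linearr u)).
HB.instance Definition _ := @isHermitianSesquilinear.Build C dsum false
  (@Num.conj C) dsum_inner dsum_inner_herm.
HB.instance Definition _ := @isDotProduct.Build C dsum dsum_inner dsum_inner_gt0.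

Lemma dsum_normr_sqr_inner (p : dsum) : `|p| ^+ 2 = dsum_inner p p.
Proof. by rewrite dsum_normr_sqr !normr_sqr_inner. Qed.

HB.instance Definition _ := @CompleteNormedModule_isHilbert.Build R dsum
  dsum_inner dsum_normr_sqr_inner.

End DirectSum.

(** * Density, separability and conjugations on direct sums *)

Section Density.
Variable R : realType.

Lemma denseP (H : hilbertType R) (S : set H) :
  closure S = setT <->
  forall (x : H) (e : R[i]), 0 < e -> exists2 y, S y & `|x - y| < e.
Proof.
split=> [S_dense x e e0|S_dense].
  have : closure S x by rewrite S_dense.
  move=> /(_ (ball x e) (nbhsx_ballx x e e0)) [y [Sy]].
  by rewrite -ball_normE /=; exists y.
apply/seteqP; split=> // x _ U /nbhs_ballP[e e0 xU].
have [y Sy xy] := S_dense x e e0.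
by exists y; split=> //; apply: xU; rewrite -ball_normE.
Qed.

(** If w were nonzero, a point y of S with |w - y| < |w| would contradict
    |w - y|^2 = |w|^2 + |y|^2. *)
Lemma dense_orth0 (H : hilbertType R) (S : set H) (w : H) :
  closure S = setT -> (forall y, S y -> inner y w = 0) -> w = 0.
Proof.
move=> /denseP S_dense Sw; apply/eqP/negPn/negP => w0.
have [|y Sy] := S_dense w `|w|; first by rewrite normr_gt0.
rewrite -ltr_sqr ?nnegrE// !normr_sqr_inner.
rewrite linearBl/= !linearBr/= (inner_conj w y) (Sw y Sy) conjC0 sub0r subr0.
by rewrite opprK -!normr_sqr_inner => /lt_geF; rewrite lerDl exprn_ge0.
Qed.

Lemma dsum_dense (H K : hilbertType R) (S : set H) (T : set K) :
  closure S = setT -> closure T = setT ->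
  closure [set p : dsum H K | S p.1 /\ T p.2] = setT.
Proof.
move=> /denseP S_dense /denseP T_dense; apply/denseP => -[x y] e e0.
have e20 : 0 < e / 2 by rewrite divr_gt0.
have [x' Sx' xx'] := S_dense x _ e20; have [y' Ty' yy'] := T_dense y _ e20.
exists (x', y') => //; apply: le_lt_trans (dsum_le _) _ => /=.
by rewrite [ltRHS]splitr ltrD.
Qed.

Lemma dense_sub (H : hilbertType R) (S T : set H) :
  S `<=` T -> closure S = setT -> closure T = setT.
Proof.
move=> ST S_dense; apply/seteqP; split=> // x _.
by apply: (closure_subset ST); rewrite S_dense.
Qed.

Lemma dsum_separable (H K : hilbertType R) :
  separable_space H -> separable_space K -> separable_space (dsum H K).
Proof.
move=> [S S_count S_dense] [T T_count T_dense].
exists [set p : dsum H K | S p.1 /\ T p.2]; last exact: dsum_dense.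
exact: (countableX S_count T_count).
Qed.

Definition dsum_inl (H K : hilbertType R) (x : H) : dsum H K := (x, 0).

Lemma dsum_inl_embedding (H K : hilbertType R) :
  closed_subspace_embedding (@dsum_inl H K).
Proof.
split.
- by move=> a x y; congr pair; rewrite /= scaler0 addr0.
- by move=> x y; rewrite /inner /= /dsum_inner /= linear0l addr0.
- move=> [x y] xy; exists x => //; congr pair; apply/esym/eqP/negPn/negP => y0.
  have e0 : 0 < `|y| by rewrite normr_gt0.
  have [_ [[z _ <-]]] := xy _ (nbhsx_ballx ((x, y) : dsum H K) _ e0).
  rewrite -ball_normE /= => /(le_lt_trans (dsum_snd_le _)) /=.
  by rewrite subr0 ltxx.
Qed.

Definition dsum_conj (H K : hilbertType R) (J : H -> H) (J' : K -> K)
  (p : dsum H K) : dsum H K := (J p.1, J' p.2).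

Lemma dsum_conjugation (H K : hilbertType R) (J : H -> H) (J' : K -> K) :
  conjugation J -> conjugation J' -> conjugation (dsum_conj J J').
Proof.
move=> [Jlin JK Jinner] [J'lin J'K J'inner]; split.
- by move=> a x y; congr pair; [exact: Jlin|exact: J'lin].
- by move=> [x y]; rewrite /dsum_conj /= JK J'K.
- by move=> x y; rewrite /inner /= /dsum_inner /= Jinner J'inner.
Qed.

End Density.

(** * Operators with self-orthogonal graph *)

Section Relations.
Variables (R : realType) (V : hilbertType R) (J : V -> V).
Hypothesis J_conj : conjugation J.
Implicit Types (x y z u v : V) (L : set (V * V)).

Lemma conjugationK x : J (J x) = x.
Proof. by case: J_conj. Qed.

Lemma conjugationD x y : J (x + y) = J x + J y.
Proof.
by have [/(_ 1 x y) Jlin _ _] := J_conj; rewrite !(conjC1, scale1r) in Jlin.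
Qed.

Lemma conjugation0 : J 0 = 0.
Proof. by apply: (addrI (J 0)); rewrite -conjugationD !addr0. Qed.

Lemma conjugationN x : J (- x) = - J x.
Proof. by apply: (addrI (J x)); rewrite -conjugationD !subrr conjugation0. Qed.

Lemma Jform_sym x y : Jform J x y = Jform J y x.
Proof.
have [_ _ Jinner] := J_conj.
by rewrite /Jform -[in LHS](conjugationK x) Jinner.
Qed.

Lemma Jform_linear y : scalar (Jform J ^~ y).
Proof. by move=> a x z; rewrite /Jform linearDl/= linearZl_LR. Qed.

Lemma Jform_dense0 (S : set V) x :
  closure S = setT -> (forall y, S y -> Jform J x y = 0) -> x = 0.
Proof.
move=> S_dense Sx; rewrite -(conjugationK x).
rewrite (dense_orth0 S_dense (w := J x)) ?conjugation0// => y Sy.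
by rewrite -[LHS]/(Jform J y x) Jform_sym Sx.
Qed.

(** [skew_form p q = 0] and [isometric_form p q = 0] are the identities
    [u, y] = - [x, v] and [u, v] = [x, y] for p = (x, u) and q = (y, v). *)
Definition skew_form (p q : V * V) : R[i] :=
  Jform J p.2 q.1 + Jform J p.1 q.2.

Definition isometric_form (p q : V * V) : R[i] :=
  Jform J p.2 q.2 - Jform J p.1 q.1.

Lemma skew_form_sym p q : skew_form p q = skew_form q p.
Proof. by rewrite /skew_form addrC !(Jform_sym _ q.1, Jform_sym _ q.2). Qed.

Lemma skew_form_linear q : scalar (skew_form^~ q).
Proof. by move=> a x y; rewrite /skew_form /= !Jform_linear; ring. Qed.

Lemma isometric_form_sym p q : isometric_form p q = isometric_form q p.
Proof. by rewrite /isometric_form !(Jform_sym _ q.1, Jform_sym _ q.2). Qed.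

Lemma isometric_form_linear q : scalar (isometric_form^~ q).
Proof. by move=> a x y; rewrite /isometric_form /= !Jform_linear; ring. Qed.

(** The operator with graph [L], provided that the relation [L] is
    single-valued. *)
Definition op_of L : hop V :=
  HOp [set x | exists u, L (x, u)] (fun x => xget 0 [set u | L (x, u)]).

Definition op_graph (A : hop V) : set (V * V) :=
  [set p | dom A p.1 /\ A p.1 = p.2].

Section SubspaceGraph.
Variable L : set (V * V).
Hypothesis L_sub : forall (a : R[i]) p q, L p -> L q -> L (a *: p + q).
Hypothesis L_fun : forall u, L (0, u) -> u = 0.

Lemma op_of_graph x : dom (op_of L) x -> L (x, op_of L x).
Proof.
by move=> [u Lu]; apply: (xgetPex 0 (P := [set u | L (x, u)])); exists u.
Qed.

Lemma op_of_val x u : L (x, u) -> op_of L x = u.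
Proof.
move=> Lu; apply/esym/eqP; rewrite -subr_eq0; apply/eqP; apply: L_fun.
have Lx : L (x, op_of L x) by apply: op_of_graph; exists u.
have := L_sub (-1) Lx Lu; congr (L (_, _)) => /=; rewrite scaleN1r addrC//.
by rewrite subrr.
Qed.

End SubspaceGraph.

Lemma op_of_linear L : L 0 ->
  (forall (a : R[i]) p q, L p -> L q -> L (a *: p + q)) ->
  (forall x u, L (x, u) -> op_of L x = u) -> linear_operator (op_of L).
Proof.
move=> L0 L_sub T_val; split; first by exists 0.
move=> a x y /op_of_graph Lx /op_of_graph Ly.
have Lxy := L_sub a _ _ Lx Ly; split; last exact: T_val Lxy.
by exists (a *: op_of L x + op_of L y).
Qed.

Section SelfOrthogonal.
Variables (B : V * V -> V * V -> R[i]) (L : set (V * V)).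
Hypothesis B_linear : forall q, scalar (B^~ q).
Hypothesis L_selforth : orth B L = L.

Lemma selforth_comb (a : R[i]) p q : L p -> L q -> L (a *: p + q).
Proof. by rewrite -L_selforth; apply: orth_comb. Qed.

Lemma selforth0 : L 0.
Proof. by rewrite -L_selforth; apply: orth0. Qed.

Lemma selforthE p : L p <-> forall q, L q -> B p q = 0.
Proof. by split=> [|Lp]; rewrite -[in X in X p]L_selforth. Qed.

End SelfOrthogonal.

(** The form pairs (0, u) with (y, v) to [u, y], and y ranges over a dense
    set, so [L] is single-valued. *)
Lemma skew_form_val L x u :
  orth skew_form L = L -> closure (dom (op_of L)) = setT ->
  L (x, u) -> op_of L x = u.
Proof.
move=> L_selforth dom_dense.
apply: op_of_val; first exact: selforth_comb skew_form_linear L_selforth.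
move=> w /(selforthE L_selforth) Lw; apply: (Jform_dense0 dom_dense) => y [v Lv].
have := Lw _ Lv.
by rewrite /skew_form /= {2}/Jform linear0l addr0.
Qed.

Lemma isometric_form_val L x u :
  orth isometric_form L = L -> closure [set u | exists x, L (x, u)] = setT ->
  L (x, u) -> op_of L x = u.
Proof.
move=> L_selforth ran_dense.
apply: op_of_val; first exact: selforth_comb isometric_form_linear L_selforth.
move=> w /(selforthE L_selforth) Lw; apply: (Jform_dense0 ran_dense) => v [y Lv].
have := Lw _ Lv.
by rewrite /isometric_form /= {2}/Jform linear0l subr0.
Qed.

(** The relation (T x, y) = (x, z) for all x in the domain of T says that
    (J y, - J z) is orthogonal to the graph [L] of T, hence belongs to it; so
    the adjoint sends y to z exactly when T sends J y to - J z. *)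
Theorem skew_form_selforth L :
  orth skew_form L = L -> closure (dom (op_of L)) = setT ->
  Jskew_selfadjoint J (op_of L).
Proof.
move=> L_selforth dom_dense.
have L_sub := selforth_comb skew_form_linear L_selforth.
have L0 := selforth0 skew_form_linear L_selforth.
have LE := selforthE L_selforth.
have T_graph := @op_of_graph L.
have T_val x u := skew_form_val (x := x) (u := u) L_selforth dom_dense.
have adjE y z : (forall x, dom (op_of L) x -> inner (op_of L x) y = inner x z)
    <-> L (J y, - J z).
  rewrite LE; split=> [yz [x u] Lxu|yz x /T_graph /yz].
    have [xd <-] : dom (op_of L) x /\ op_of L x = u.
      by split; [exists u|exact: T_val].
    have := yz x xd; rewrite /skew_form /=.
    rewrite (Jform_sym (J y)) (Jform_sym (- J z)) /Jform conjugationN.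
    by rewrite !conjugationK linearNr/= => ->; rewrite addNr.
  rewrite /skew_form /= (Jform_sym (J y)) (Jform_sym (- J z)) /Jform conjugationN.
  by rewrite !conjugationK linearNr/= addrC => /eqP; rewrite subr_eq0 => /eqP.
split=> //; first exact: op_of_linear.
split=> [|y].
  apply/seteqP; split=> y /=.
    move=> [u Lu]; exists (- J u); apply/adjE.
    by rewrite conjugationN conjugationK opprK.
  by move=> [z /adjE Lz]; exists (- J z).
move=> [u Lu].
pose rel :=
  [set z | forall x, dom (op_of L) x -> inner (op_of L x) y = inner x z].
have /adjE /T_val Ty : rel (xget 0 rel).
  apply: xgetPex; exists (- J u); apply/adjE.
  by rewrite conjugationN conjugationK opprK.
rewrite -[LHS]/(J (op_of L (J y))) -[RHS]/(- xget 0 rel) Ty.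
by rewrite conjugationN conjugationK.
Qed.

(** As for [skew_form_selforth]: the adjoint sends y to z exactly when
    (J z, J y) is orthogonal to the graph, that is when T sends J z to J y.
    Density of the domain makes T injective, in the same way as density of the
    range makes it single-valued. *)
Theorem isometric_form_selforth L :
  orth isometric_form L = L -> closure (dom (op_of L)) = setT ->
  closure [set u | exists x, L (x, u)] = setT ->
  Junitary J (op_of L).
Proof.
move=> L_selforth dom_dense ran_dense.
have L_sub := selforth_comb isometric_form_linear L_selforth.
have L0 := selforth0 isometric_form_linear L_selforth.
have LE := selforthE L_selforth.
have L_inj x : L (x, 0) -> x = 0.
  move=> /LE Lx; apply: (Jform_dense0 dom_dense) => y [v Lv].
  have := Lx _ Lv.
  by rewrite /isometric_form /= {1}/Jform linear0l sub0r => /eqP;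
    rewrite oppr_eq0 => /eqP.
have T_graph := @op_of_graph L.
have T_val x u :=
  isometric_form_val (x := x) (u := u) L_selforth ran_dense.
have T_inj x y u : L (x, u) -> L (y, u) -> x = y.
  move=> Lx Ly; apply/eqP; rewrite -subr_eq0; apply/eqP; apply: L_inj.
  have := L_sub (-1) _ _ Ly Lx; congr (L (_, _)) => /=; rewrite scaleN1r addrC//.
  by rewrite subrr.
have adjE y z : (forall x, dom (op_of L) x -> inner (op_of L x) y = inner x z)
    <-> L (J z, J y).
  rewrite LE; split=> [yz [x u] Lxu|yz x /T_graph /yz].
    have [xd <-] : dom (op_of L) x /\ op_of L x = u.
      by split; [exists u|exact: T_val].
    have := yz x xd; rewrite /isometric_form /=.
    rewrite (Jform_sym (J y)) (Jform_sym (J z)) /Jform.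
    by rewrite !conjugationK => ->; rewrite subrr.
  rewrite /isometric_form /= (Jform_sym (J y)) (Jform_sym (J z)) /Jform.
  by rewrite !conjugationK => /eqP; rewrite subr_eq0 => /eqP.
split=> //; first exact: op_of_linear.
  by move=> x y /T_graph Lx /T_graph Ly xy; rewrite xy in Lx; apply: T_inj Lx Ly.
split=> [|y].
  apply/seteqP; split=> y /=.
    move=> [x /T_graph Lx xy]; exists (J x); apply/adjE.
    by rewrite conjugationK -xy.
  move=> [z /adjE Lz]; exists (J z); first by exists (J y).
  exact: T_val.
move=> [x /T_graph Lx xy].
pose rel :=
  [set z | forall x, dom (op_of L) x -> inner (op_of L x) y = inner x z].
have /adjE Ladj : rel (xget 0 rel).
  by apply: xgetPex; exists (J x); apply/adjE; rewrite conjugationK -xy.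
have [/T_graph Linv invE] : dom (op_of L) (invop (op_of L) (J y)) /\
    op_of L (invop (op_of L) (J y)) = J y.
  apply: (xgetPex 0 (P := [set x | dom (op_of L) x /\ op_of L x = J y])).
  by exists x; split=> //; exists (op_of L x).
rewrite invE in Linv.
rewrite -[LHS]/(J (invop (op_of L) (J y))) -[RHS]/(xget 0 rel).
by rewrite (T_inj _ _ _ Linv Ladj) conjugationK.
Qed.

End Relations.

(** * The doubled operator *)

Section DoubledOperator.
Variables (R : realType) (H : hilbertType R).
Variables (B : H * H -> H * H -> R[i]).
Hypothesis B_sym : forall p q, B p q = B q p.
Hypothesis B_linear : forall q, scalar (B^~ q).
Variable A : hop H.
Hypothesis A_isotropic : op_graph A `<=` orth B (op_graph A).

(** A point of the graph space of [dsum H H], regrouped as a pair of points of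
    the graph space of [H]. *)
Definition interchange (p : dsum H H * dsum H H) : (H * H) * (H * H) :=
  ((p.1.1, p.2.1), (p.1.2, p.2.2)).

Definition doubled_graph : set (dsum H H * dsum H H) :=
  interchange @^-1` doubling B (op_graph A).

(** [interchange] is bijective and carries [Bt] to [double_form B], so it
    transports [doubling_selforth]. *)
Lemma doubled_graph_selforth
    (Bt : dsum H H * dsum H H -> dsum H H * dsum H H -> R[i]) :
  (forall p q, Bt p q = double_form B (interchange p) (interchange q)) ->
  orth Bt doubled_graph = doubled_graph.
Proof.
move=> BtE; rewrite /doubled_graph.
rewrite -[in RHS](doubling_selforth B_sym B_linear A_isotropic).
apply/seteqP; split=> [p pD [[x u] [y v]] xy|p pD q qD].
  have := pD ((x, y), (u, v)); rewrite BtE; exact.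
by rewrite BtE; apply: pD.
Qed.

Lemma doubled_graph_mem x y : dom A x -> dom A y ->
  doubled_graph ((x, y), (A x, A y)).
Proof.
move=> Ax Ay; split=> /=; first exact: A_isotropic.
rewrite addrC -scaleNr; apply: orth_comb => //; exact: sub_biorth.
Qed.

Lemma doubled_graph_inl x : dom A x ->
  doubled_graph (dsum_inl H x, dsum_inl H (A x)).
Proof.
move=> Ax; split=> /=; first exact: A_isotropic.
have -> : (0, 0) = 0 :> H * H by [].
by rewrite sub0r -scaleNr; apply: orthZ => //; apply: sub_biorth.
Qed.

Lemma doubled_dom_dense : closure (dom A) = setT ->
  closure (dom (op_of doubled_graph)) = setT.
Proof.
move=> A_dense; apply: dense_sub (dsum_dense A_dense A_dense).
move=> [x y] [/= Ax Ay]; exists (A x, A y); exact: doubled_graph_mem.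
Qed.

Lemma doubled_ran_dense : closure (ran A) = setT ->
  closure [set u | exists x, doubled_graph (x, u)] = setT.
Proof.
move=> A_dense; apply: dense_sub (dsum_dense A_dense A_dense).
move=> [u v] [/= [x Ax <-] [y Ay <-]]; exists (x, y); exact: doubled_graph_mem.
Qed.

End DoubledOperator.

Theorem theorem1 (R : realType) (H : hilbertType R) (hH : separable_space H)
    (J : H -> H) (hJ : conjugation J)
    (A : hop H) (hA : linear_operator A) :
  (Jskew_symmetric J A -> closure (dom A) = setT ->
    exists (Ht : hilbertType R) (iota : H -> Ht) (Jt : Ht -> Ht) (At : hop Ht),
      [/\ separable_space Ht, closed_subspace_embedding iota,
          conjugation Jt /\ extends_conj iota J Jt &
          Jskew_selfadjoint Jt At /\ extends_op iota A At])
  /\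
  (Jisometric J A -> closure (dom A) = setT -> closure (ran A) = setT ->
    exists (Ht : hilbertType R) (iota : H -> Ht) (Jt : Ht -> Ht) (At : hop Ht),
      [/\ separable_space Ht, closed_subspace_embedding iota,
          conjugation Jt /\ extends_conj iota J Jt &
          Junitary Jt At /\ extends_op iota A At]).
Proof.
have Jt_conj : conjugation (dsum_conj J J) by exact: dsum_conjugation.
have Jt_ext : extends_conj (@dsum_inl _ H H) J (dsum_conj J J).
  by move=> x; congr pair; rewrite /= conjugation0.
have JtE (p q : dsum H H) :
    Jform (dsum_conj J J) p q = Jform J p.1 q.1 + Jform J p.2 q.2 by [].
split=> [A_skew A_dense|A_iso A_dense A_ran].
  have A_isotropic : op_graph A `<=` orth (skew_form J) (op_graph A).
    move=> [x _] [/= Ax <-] [y _] [/= Ay <-].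
    by rewrite /skew_form /= A_skew// addNr.
  pose L := doubled_graph (skew_form J) A.
  have L_selforth : orth (skew_form (dsum_conj J J)) L = L.
    apply: doubled_graph_selforth => //; first exact: skew_form_sym.
      exact: skew_form_linear.
    by move=> p q; rewrite /skew_form /double_form /= !JtE; ring.
  have L_dense : closure (dom (op_of L)) = setT.
    apply: doubled_dom_dense => //; first exact: skew_form_sym.
    exact: skew_form_linear.
  exists (dsum H H), (@dsum_inl _ H H), (dsum_conj J J), (op_of L); split=> //.
  - exact: dsum_separable.
  - exact: dsum_inl_embedding.
  split=> [|x Ax]; first exact: skew_form_selforth.
  have Lx : L (dsum_inl H x, dsum_inl H (A x)).
    apply: doubled_graph_inl => //; first exact: skew_form_sym.
    exact: skew_form_linear.
  split; first by exists (dsum_inl H (A x)).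
  exact: (skew_form_val Jt_conj L_selforth L_dense Lx).
have A_isotropic : op_graph A `<=` orth (isometric_form J) (op_graph A).
  move=> [x _] [/= Ax <-] [y _] [/= Ay <-].
  by rewrite /isometric_form /= A_iso// subrr.
pose L := doubled_graph (isometric_form J) A.
have L_selforth : orth (isometric_form (dsum_conj J J)) L = L.
  apply: doubled_graph_selforth => //; first exact: isometric_form_sym.
    exact: isometric_form_linear.
  by move=> p q; rewrite /isometric_form /double_form /= !JtE; ring.
have L_dense : closure (dom (op_of L)) = setT.
  apply: doubled_dom_dense => //; first exact: isometric_form_sym.
  exact: isometric_form_linear.
have L_ran : closure [set u | exists x, L (x, u)] = setT.
  apply: doubled_ran_dense => //; first exact: isometric_form_sym.
  exact: isometric_form_linear.
exists (dsum H H), (@dsum_inl _ H H), (dsum_conj J J), (op_of L); split=> //.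
- exact: dsum_separable.
- exact: dsum_inl_embedding.
split=> [|x Ax]; first exact: isometric_form_selforth.
have Lx : L (dsum_inl H x, dsum_inl H (A x)).
  apply: doubled_graph_inl => //; first exact: isometric_form_sym.
  exact: isometric_form_linear.
split; first by exists (dsum_inl H (A x)).
exact: (isometric_form_val Jt_conj L_selforth L_ran Lx).
Qed.
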